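(* Let $k$ be a positive integer. Every $(12k-1)$-edge connected, essentially $(2k+1)$-unbalanced signed graph $(G,\sigma)$ has a modulo $(2k+1)$-orientation.
   Context: A signed graph is a pair $(G,\sigma)$ where $G$ is a graph and $\sigma:E(G)\to\{1,-1\}$; edges with $\sigma(e)=1$ are positive, those with $\sigma(e)=-1$ negative. An orientation $\tau$ of $(G,\sigma)$ orients each positive edge $e=xy$ from one end to the other (if from $x$ to $y$, then $e\in E^+_\tau(x)\cap E^-_\tau(y)$), and labels each negative edge $e=xy$ either as a sink edge, with $e\in E^+_\tau(x)\cap E^+_\tau(y)$, or as a source edge, with $e\in E^-_\tau(x)\cap E^-_\tau(y)$. Write $d^\pm_\tau(x)=|E^\pm_\tau(x)|$. A modulo $(2k+1)$-orientation is an orientation $\tau$ with $d^+_\tau(x)-d^-_\tau(x)\equiv 0\pmod{2k+1}$ for every vertex $x$. Switching at a vertex $v$ negates the sign of every edge incident to $v$. Two signed graphs on the same underlying graph are equivalent if one is obtained from the other by a sequence of switchings. $(G,\sigma)$ is essentially $(2k+1)$-unbalanced if every signed graph equivalent to it has either an even number of negative edges or at least $2k+1$ negative edges. Edge connectivity refers to $G$. *)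

(* Defs.v *)
From mathcomp Require Import all_boot.
Set Implicit Arguments. Unset Strict Implicit. Unset Printing Implicit Defensive.

Record graph (V E : finType) := Graph {
  end1 : E -> V;
  end2 : E -> V;
  loopless : forall e, end1 e != end2 e }.

Section SignedGraphs.
Variables (V E : finType) (G : graph V E).

Definition incident (x : V) (e : E) : bool := (end1 G e == x) || (end2 G e == x).

(* A signature: sigma e = true means e is NEGATIVE (sigma(e) = -1),
   sigma e = false means e is positive. *)
Definition signature := E -> bool.

Definition neg_edges (sigma : signature) : nat := #|[pred e | sigma e]|.

Definition switch (v : V) (sigma : signature) : signature :=
  fun e => if incident v e then ~~ sigma e else sigma e.

Inductive sig_equiv (sigma : signature) : signature -> Prop :=
  | sig_equiv_refl : sig_equiv sigma sigma
  | sig_equiv_step v tau : sig_equiv sigma tau -> sig_equiv sigma (switch v tau).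

Definition essentially_unbalanced (k : nat) (sigma : signature) : Prop :=
  forall tau, sig_equiv sigma tau ->
    ~~ odd (neg_edges tau) || (2 * k + 1 <= neg_edges tau).

Definition cut_size (X : {set V}) : nat :=
  #|[pred e | (end1 G e \in X) != (end2 G e \in X)]|.

Definition edge_connected (m : nat) : Prop :=
  forall X : {set V}, X != set0 -> X != setT -> m <= cut_size X.

(* An orientation tau : E -> bool.
   - positive edge e (sigma e = false): tau e = true means e is oriented from
     end1 e to end2 e (so e is in E^+(end1 e) and E^-(end2 e)); tau e = false
     means from end2 e to end1 e.
   - negative edge e (sigma e = true): tau e = true means e is a sink edge
     (e in E^+ of both ends); tau e = false means a source edge
     (e in E^- of both ends). *)
Definition orientation := E -> bool.

Definition in_Eplus (sigma : signature) (tau : orientation) (x : V) (e : E) : bool :=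
  if sigma e then incident x e && tau e
  else if tau e then end1 G e == x else end2 G e == x.

Definition in_Eminus (sigma : signature) (tau : orientation) (x : V) (e : E) : bool :=
  if sigma e then incident x e && ~~ tau e
  else if tau e then end2 G e == x else end1 G e == x.

Definition dplus sigma tau x : nat := #|[pred e | in_Eplus sigma tau x e]|.
Definition dminus sigma tau x : nat := #|[pred e | in_Eminus sigma tau x e]|.

Definition mod_orientation (m : nat) sigma (tau : orientation) : Prop :=
  forall x : V, dplus sigma tau x = dminus sigma tau x %[mod m].

End SignedGraphs.

(* Main.v *)
(* Switch so that the number of negative edges is minimal.  Every cut then has
   at least as many positive as negative edges, so the positive subgraph is
   6k-edge connected.  Since the number N of negative edges is even or at least
   m = 2k+1, some c <= N of them can be made sink edges with 2c = N mod m, and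
   the rest source edges; it remains to orient the positive edges with
   prescribed out-degrees mod m.  This is possible in every (3m-3)-edge
   connected graph by a theorem of Lovasz, Thomassen, Wu and Zhang, proved here
   by induction in a stronger form with an apex vertex z0 whose edges are
   already oriented.  Small cuts are contracted one side at a time; otherwise
   every cut is slack, and one may delete an edge x -> y unless the required
   out-degree of x is pinned to the lower end of its admissible interval or that
   of y to the upper end.  A vertex pinned at both ends is split off; if all are
   pinned at the same end, edges towards z0 are moved to one vertex until it is
   no longer pinned. *)
Require Import Defs.
From mathcomp Require Import all_boot.
From mathcomp Require Import order ssralg ssrnum ssrint intdiv zify.
Import Order.TTheory GRing.Theory Num.Theory.

(** * Cut conditions and prescribed out-degrees modulo [m] *)

Section BoundaryOrientations.
Local Open Scope ring_scope.
Local Set Implicit Arguments.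
Local Unset Strict Implicit.
Local Unset Printing Implicit Defensive.

Variables (V E : finType) (m : int).
Hypothesis m_ge3 : 3 <= m.

Implicit Types (A B U X : {set V}) (F : {set E}) (s t h : E -> V).
Implicit Types (p a b f : V -> int) (x y z v r : V) (e : E) (c d lo hi : int).

Definition wt f A : int := \sum_(x in A) f x.

Definition ecut F s t A : int :=
  \sum_(e in F) ((s e \in A) (+) (t e \in A))%:Z.

Definition einn F s t A : int :=
  \sum_(e in F) ((s e \in A) && (t e \in A))%:Z.

Definition outdeg F h x : int := \sum_(e in F) (h e == x)%:Z.

(* The number of edges that leave [A] when the out-degrees are [p]: each edge
   inside [A] contributes 1 to [wt p A]. *)
Definition need F s t p A : int := wt p A - einn F s t A.

(* Some integer congruent to [c] mod [m] lies in [lo, hi]; see [hitsP]. *)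
Definition hits c lo hi : bool := ((c - lo) %% m)%Z <= hi - lo.

(* [a v] and [b v] are the numbers of apex edges z0 -> v and v -> z0.  If tau(A)
   is the least absolute residue mod 2m of the required net out-flow of [A] and
   d(A) its degree, both including the apex edges, then the condition with
   [d1 = d2 = 0] reads d(A) >= 2m - 2 + |tau(A)|; [d1] and [d2] shrink the
   interval at its two ends. *)
Definition cut_ok F s t p a b d1 d2 A : bool :=
  hits (need F s t p A) (m - 1 - wt b A + d1)
       (ecut F s t A + wt a A - (m - 1) - d2).

(* [X] is empty or a single vertex, exempt from the cut condition because its
   required net out-flow is 0.  [v_reg] is d(z0) <= 2m - 2 + |tau(z0)|. *)
Record valid U F s t p a b X : Prop := Valid {
  v_ends : forall e, e \in F -> (s e \in U) && (t e \in U);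
  v_a : forall x, 0 <= a x;
  v_b : forall x, 0 <= b x;
  v_tot : exists j, need F s t p U = j * m;
  v_reg : wt a U <= m - 1 /\ wt b U <= 2 * m - 1 \/
          wt a U <= 2 * m - 1 /\ wt b U <= m - 1;
  v_X : (X \subset U) && (#|X| <= 1)%N;
  v_ex : forall x, x \in X -> exists j,
    2 * (need F s t p [set x] + j * m) = ecut F s t [set x] + a x - b x;
  v_cut : forall A, A \proper U -> A != set0 -> A != X ->
    cut_ok F s t p a b 0 0 A }.

(* [h e] is the tail of the edge [e]. *)
Definition orientable U F s t p : Prop := exists h,
  (forall e, e \in F -> h e = s e \/ h e = t e) /\
  (forall x, x \in U -> exists j, outdeg F h x = p x + j * m).

Lemma hitsP c lo hi :
  reflect (exists j, lo <= c + j * m <= hi) (hits c lo hi).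
Proof.
have m0 : 0 < m by lia.
apply: (iffP idP) => [H|[j /andP[H1 H2]]].
  exists (- ((c - lo) %/ m)%Z); move: H; rewrite /hits.
  have := divz_eq (c - lo) m; have := modz_ge0 (c - lo) (lt0r_neq0 m0).
  nia.
rewrite /hits -(modzMDl j).
have -> : j * m + (c - lo) = c + j * m - lo by lia.
have := divz_eq (c + j * m - lo) m.
have : (0 <= (c + j * m - lo) %/ m)%Z by rewrite divz_ge0 //; lia.
nia.
Qed.

Lemma wt1 f x : wt f [set x] = f x.
Proof. exact: big_set1. Qed.

Lemma wt_ge0 f A : (forall x, 0 <= f x) -> 0 <= wt f A.
Proof. by move=> f0; apply: sumr_ge0. Qed.

Lemma wtD f1 f2 A : wt (fun v => f1 v + f2 v) A = wt f1 A + wt f2 A.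
Proof. exact: big_split. Qed.

Lemma wtB f1 f2 A : wt (fun v => f1 v - f2 v) A = wt f1 A - wt f2 A.
Proof. exact: sumrB. Qed.

Lemma wtID f A B : B \subset A -> wt f A = wt f B + wt f (A :\: B).
Proof. by move=> sBA; rewrite /wt (big_setID B) /= (setIidPr sBA). Qed.

Lemma wt_ind x A : \sum_(v in A) (x == v)%:Z = (x \in A)%:Z.
Proof.
case xA: (x \in A).
  rewrite (big_setD1 x) //= eqxx big1 // => v.
  by rewrite !inE eq_sym => /andP[/negbTE ->].
by rewrite big1 // => v vA; case: eqP => // xv; rewrite xv vA in xA.
Qed.

Definition upd f x c : V -> int := fun v => f v + c * (x == v)%:Z.

Lemma wt_upd f x c A : wt (upd f x c) A = wt f A + c * (x \in A)%:Z.
Proof. by rewrite /upd wtD -(wt_ind x A) /wt mulr_sumr. Qed.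

Lemma wt_outdeg F h A : wt (outdeg F h) A = \sum_(e in F) (h e \in A)%:Z.
Proof.
rewrite /wt /outdeg exchange_big /=; apply: eq_bigr => e _; exact: wt_ind.
Qed.

Lemma ecut_ge0 F s t A : 0 <= ecut F s t A.
Proof. by apply: sumr_ge0. Qed.

Lemma ecutC U F s t A : (forall e, e \in F -> (s e \in U) && (t e \in U)) ->
  ecut F s t (U :\: A) = ecut F s t A.
Proof.
move=> ends; apply: eq_bigr => e /ends/andP[sU tU].
by rewrite !inE sU tU; do 2 case: (_ \in A).
Qed.

(** An edge of [U] lies inside [A], inside the complement or across. Under [v_tot] the requirements
    of the two sides therefore add up to [ecut] modulo [m]: each cut edge leaves exactly one
    side. *)
Lemma needC U F s t p A : (forall e, e \in F -> (s e \in U) && (t e \in U)) ->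
  A \subset U ->
  need F s t p U = need F s t p A + need F s t p (U :\: A) - ecut F s t A.
Proof.
move=> ends sAU; rewrite /need (wtID p sAU).
suff -> : einn F s t U =
    einn F s t A + einn F s t (U :\: A) + ecut F s t A by lia.
rewrite /einn /ecut -!big_split /=; apply: eq_bigr => e /ends/andP[sU tU].
by rewrite !inE sU tU; do 2 case: (_ \in A).
Qed.

Lemma einnT U F s t : (forall e, e \in F -> (s e \in U) && (t e \in U)) ->
  einn F s t U = #|F|%:Z.
Proof.
move=> ends; rewrite /einn (eq_bigr (fun=> 1)) => [|e /ends -> //].
by rewrite sumr_const natz.
Qed.

(** * Edge reversal and contraction of a set without slack *)

Definition orientable_below n := forall U F s t p a b X,
  (#|U| + #|F| < n)%N -> valid U F s t p a b X -> orientable U F s t p.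

(* Reversing all edges exchanges the roles of [a] and [b]. *)
Definition rev_out F s t p v := outdeg F s v + outdeg F t v - p v.

(** Cut edges leaving [A] enter it after reversal. The count is the handshake identity for [A]. *)
Lemma need_reverse F s t p A :
  need F s t (rev_out F s t p) A = ecut F s t A - need F s t p A.
Proof.
rewrite /need /rev_out wtB wtD !wt_outdeg.
suff : einn F s t A *+ 2 + ecut F s t A =
  \sum_(e in F) (s e \in A)%:Z + \sum_(e in F) (t e \in A)%:Z.
  by clear; lia.
rewrite mulr2n /einn /ecut -!big_split /=; apply: eq_bigr => e _.
by do 2 case: (_ \in A).
Qed.

Lemma cut_ok_reverse F s t p a b d1 d2 A :
  cut_ok F s t (rev_out F s t p) b a d1 d2 A = cut_ok F s t p a b d2 d1 A.
Proof.
apply/hitsP/hitsP => -[i Hi]; exists (- i); move: Hi; rewrite need_reverse;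
by clear; lia.
Qed.

Lemma valid_reverse U F s t p a b :
  valid U F s t p a b set0 -> valid U F s t (rev_out F s t p) b a set0.
Proof.
case=> ends a0 b0 [j tot] reg XU _ cU; split=> //.
- exists (- j); rewrite need_reverse tot.
  have -> : ecut F s t U = 0 by apply: big1 => e /ends/andP[-> ->].
  by clear; lia.
- by case: reg => -[H1 H2]; [right|left].
- by move=> x; rewrite inE.
- by move=> A pA A0 AX; rewrite cut_ok_reverse; apply: cU.
Qed.

Lemma orientable_reverse U F s t p :
  orientable U F s t (rev_out F s t p) -> orientable U F s t p.
Proof.
case=> h [hst hp].
exists (fun e => if h e == s e then t e else s e); split.
  by move=> e eF; case: ifP; [right|left].
move=> x xU; have [j hj] := hp x xU; exists (- j).
have: outdeg F h x + outdeg F (fun e => if h e == s e then t e else s e) x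
    = outdeg F s x + outdeg F t x.
  rewrite /outdeg -!big_split /=; apply: eq_bigr => e eF.
  case: (h e =P s e) => [->//|hs]; case: (hst e eF) => // ->.
  by rewrite addrC.
by rewrite hj /rev_out; clear; lia.
Qed.

(* Orient the contraction of [A] first.  As the cut of [A] is not slack, turning
   its oriented edges into apex edges for [A] preserves [v_reg]. *)
Lemma contract_step U F s t p a b X A :
  orientable_below (#|U| + #|F|) -> valid U F s t p a b X ->
  A \proper U -> (2 <= #|A|)%N -> ~~ cut_ok F s t p a b 1 1 A ->
  orientable U F s t p.
Proof.
move=> IH [ends a0 b0 [j0 tot] reg /andP[XU X1] ex cU] pA A2 tight.
have sAU := proper_sub pA.
have /card_gt0P[r rA] : (0 < #|A|)%N by apply: leq_trans A2.
have rU : r \in U by apply: (subsetP sAU).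
(* [g] contracts [A] to its vertex [r]. The edges [F1] survive in the contraction; the edges [F2]
   are kept for the graph on [A]. *)
pose g v := if v \in A then r else v.
pose inA e := (s e \in A) && (t e \in A).
pose F1 := [set e in F | ~~ inA e]; pose F2 := [set e in F | inA e].
have splitF (phi : E -> int) : \sum_(e in F) phi e =
    \sum_(e in F1) phi e + \sum_(e in F2) phi e.
  rewrite (bigID inA) /= addrC; congr (_ + _); apply: eq_bigl => e;
  by rewrite inE.
have sF1 e : e \in F1 -> e \in F by rewrite inE => /andP[].
have nF1 e : e \in F1 -> ~~ inA e by rewrite inE => /andP[].
have sF2 e : e \in F2 -> e \in F by rewrite inE => /andP[].
have iF2 e : e \in F2 -> inA e by rewrite inE => /andP[].
pose U1 := r |: (U :\: A).
pose col f c v := if v == r then c else f v.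
(* Every cut of the contraction is the cut of a preimage under [g], so its condition is inherited
   from [lft B]. *)
pose lft B := [set v in U | g v \in B].
have U1U : U1 \subset U by rewrite subUset sub1set rU subsetDl.
have gU1 v : v \in U1 -> g v = v.
  rewrite !inE /g => /orP[/eqP->|/andP[/negbTE->]//]; by rewrite rA.
have lftE B : B \subset U1 ->
    lft B = if r \in B then A :|: (B :\ r) else B.
  move=> sB; apply/setP=> v; rewrite /lft !inE /g.
  have [vA|vA] := boolP (v \in A).
    rewrite (subsetP sAU _ vA) /=; case: ifP => rB; rewrite ?inE ?vA //.
    apply/esym; apply: contraFF rB => vB.
    by move: (subsetP sB _ vB); rewrite !inE vA orbF => /eqP <-.
  have vr : v != r by apply: contra vA => /eqP ->.
  have vU : v \in B -> v \in U by move=> /(subsetP sB)/(subsetP U1U).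
  rewrite /=; case: ifP => _; rewrite ?inE ?(negbTE vA) ?vr /=;
    by case vB: (v \in B); rewrite ?andbF // vU.
have wt_col f c B : B \subset U1 ->
    wt (col f c) B = wt f (lft B) + (r \in B)%:Z * (c - wt f A).
  move=> sB; rewrite lftE //; case: ifP => rB.
    rewrite (wtID f (subsetUl A _)) (wtID (col f c) (_ : [set r] \subset B));
      last by rewrite sub1set.
    rewrite wt1 {1}/col eqxx.
    have -> : (A :|: B :\ r) :\: A = B :\ r.
      apply/setP=> v; rewrite !inE; have [vA|//] := boolP (v \in A).
      apply/esym/negP => /andP[vr vB]; move: (subsetP sB _ vB).
      by rewrite !inE vA (negbTE vr).
    have -> : wt (col f c) (B :\ r) = wt f (B :\ r).
      by apply: eq_bigr => v; rewrite !inE /col => /andP[/negbTE->].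
    lia.
  rewrite mul0r addr0; apply: eq_bigr => v vB.
  by rewrite /col; case: eqP => // vr; rewrite -vr vB in rB.
pose s1 e := g (s e); pose t1 e := g (t e).
have lftU e B : e \in F ->
    (s1 e \in B = (s e \in lft B)) * (t1 e \in B = (t e \in lft B)).
  by move=> /ends/andP[sU tU]; rewrite !inE sU tU.
have lftA B : r \in B -> A \subset lft B.
  move=> rB; apply/subsetP => v vA; rewrite inE (subsetP sAU) //=.
  by rewrite /g vA.
have lftNA B v : r \notin B -> v \in A -> v \notin lft B.
  by move=> rB vA; rewrite inE /g vA (negbTE rB) andbF.
have ecut1 B : ecut F1 s1 t1 B = ecut F s t (lft B).
  rewrite /ecut splitF [X in _ + X]big1 ?addr0; last first.
    move=> e /iF2/andP[sA tA]; case rB: (r \in B).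
      by rewrite !(subsetP (lftA _ rB)).
    by rewrite !(negbTE (lftNA _ _ (negbT rB) _)).
  by apply: eq_bigr => e /sF1 eF; rewrite !lftU.
have einnA : einn F s t A = \sum_(e in F2) 1.
  rewrite /einn splitF big1 ?add0r.
    by apply: eq_bigr => e /iF2 /andP[-> ->].
  by move=> e /nF1/negbTE; rewrite /inA => ->.
have einn1 B : einn F1 s1 t1 B =
    einn F s t (lft B) - (r \in B)%:Z * einn F s t A.
  rewrite einnA /einn splitF.
  have -> : \sum_(e in F2) ((s e \in lft B) && (t e \in lft B))%:Z =
     (r \in B)%:Z * \sum_(e in F2) 1.
    rewrite mulr_sumr; apply: eq_bigr => e /iF2/andP[sA tA].
    case rB: (r \in B); first by rewrite !(subsetP (lftA _ rB)).
    by rewrite !(negbTE (lftNA _ _ (negbT rB) _)).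
  rewrite addrK; by apply: eq_bigr => e /sF1 eF; rewrite !lftU.
(* Each edge inside [A] has its tail in [A], so only [need F s t p A] of the demand of [A] is left
   for the contracted vertex. *)
pose p1 := col p (need F s t p A).
have need1 B : B \subset U1 -> need F1 s1 t1 p1 B = need F s t p (lft B).
  move=> sB; rewrite /need wt_col // einn1 /need.
  by case: (r \in B); clear; lia.
have lftT : lft U1 = U.
  apply/setP=> v; rewrite !inE /g; case vU: (v \in U) => //=.
  by case vA: (v \in A); rewrite ?eqxx ?vA ?vU ?orbT.
have lft_set1 x : x \in U1 -> x != r -> lft [set x] = [set x].
  move=> xU1 xr; rewrite lftE ?sub1set // inE eq_sym (negbTE xr) //.
have [] := IH U1 F1 s1 t1 p1 (col a (wt a A)) (col b (wt b A)) (X :\: A).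
- have: (#|F1| <= #|F|)%N by apply/subset_leq_card/subsetP.
  have: #|U1| = (1 + #|U :\: A|)%N by rewrite cardsU1 !inE rA.
  have := cardsID A U; rewrite (setIidPr sAU); move: A2; clear; lia.
- have wtc f B : B \subset U1 -> wt (col f (wt f A)) B = wt f (lft B).
    by move=> sB; rewrite wt_col // subrr mulr0 addr0.
  split.
  + move=> e eF; move: (ends e (sF1 e eF)); rewrite /s1 /t1 /g !inE.
    by move=> /andP[sU tU]; apply/andP; split; case: ifP => Q;
      rewrite ?eqxx ?Q ?sU ?tU ?orbT.
  + by move=> x; rewrite /col; case: ifP => // _; apply: wt_ge0.
  + by move=> x; rewrite /col; case: ifP => // _; apply: wt_ge0.
  + by exists j0; rewrite need1 // lftT.
  + by rewrite !wtc // lftT.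
  + apply/andP; split.
      apply/subsetP => x; rewrite !inE => /andP[-> /(subsetP XU)->].
      by rewrite orbT.
    by apply: leq_trans X1; apply/subset_leq_card/subsetDl.
  + move=> x; rewrite inE => /andP[xA xX]; have [j Hj] := ex x xX.
    have xr : x != r by apply: contra xA => /eqP ->.
    have xU1 : x \in U1 by rewrite !inE xA (subsetP XU) ?orbT.
    exists j; rewrite need1 ?sub1set // ecut1 lft_set1 // Hj.
    by rewrite /col (negbTE xr).
  + move=> B pB B0 BX; have sB := proper_sub pB.
    have: cut_ok F s t p a b 0 0 (lft B).
      apply: cU.
      * rewrite properE; apply/andP; split.
          by apply/subsetP => v; rewrite inE => /andP[].
        apply: contraL pB => H; rewrite properE sB /= negbK.
        apply/subsetP => v vU1; move: (subsetP H v (subsetP U1U v vU1)).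
        by rewrite inE gU1 // => /andP[].
      * have /set0Pn[v vB] := B0; apply/set0Pn; exists v.
        have vU1 := subsetP sB v vB.
        by rewrite inE gU1 // vB andbT (subsetP U1U).
      * apply: contra BX => /eqP lX.
        case rB: (r \in B).
          have := subset_leq_card (lftA _ rB); rewrite lX; move: A2 X1.
          clear; lia.
        have BX : B = X by rewrite -lX lftE // rB.
        rewrite -BX; apply/eqP/setP => v; rewrite inE.
        have [vB|//] := boolP (v \in B); last by rewrite andbF.
        rewrite andbT; apply/esym/negP => vA.
        move: (subsetP sB v vB); rewrite !inE vA orbF => /eqP vr.
        by rewrite -vr vB in rB.
    by rewrite /cut_ok need1 // ecut1 !wtc.
move=> h1 [h1st h1p].
pose h e := if h1 e == s1 e then s e else t e.
have gh e : e \in F1 -> g (h e) = h1 e.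
  by move=> eF; rewrite /h; case: eqP => [->//|hs]; case: (h1st e eF).
have hst e : h e = s e \/ h e = t e by rewrite /h; case: ifP; [left|right].
have gr v : (g v == r) = (v \in A).
  rewrite /g; case vA: (v \in A); first exact: eqxx.
  by apply/eqP => vr; rewrite vr rA in vA.
have [jO HO] := h1p r (setU11 _ _).
have OE : outdeg F1 h1 r = \sum_(e in F1) (h e \in A)%:Z.
  by apply: eq_bigr => e eF; rewrite -gr gh.
have O0 : 0 <= outdeg F1 h1 r by apply: sumr_ge0.
have Ocut : outdeg F1 h1 r <= ecut F s t A.
  rewrite OE /ecut splitF -[X in X <= _]addr0.
  apply: lerD; last exact: sumr_ge0.
  apply: ler_sum => e /nF1; rewrite /inA.
  by case: (hst e) => ->; do 2 case: (_ \in A).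
(* Oriented cut edges become apex edges of [A]: those with tail [v] count in [b2 v], those with head
   [v] in [a2 v]. *)
pose p2 v := p v - outdeg F1 h v.
pose b2 v := b v + outdeg F1 h v.
pose a2 v := a v + (outdeg F1 s v + outdeg F1 t v - outdeg F1 h v).
have einn2 B : B \subset A -> einn F2 s t B = einn F s t B.
  move=> sB; rewrite /einn splitF [X in _ = X + _]big1 ?add0r //.
  move=> e /nF1; rewrite /inA; case sE: (s e \in B) => //.
  case tE: (t e \in B) => //; by rewrite !(subsetP sB).
have ecut2 B : B \subset A -> ecut F s t B =
    ecut F2 s t B + wt (outdeg F1 s) B + wt (outdeg F1 t) B.
  move=> sB; rewrite !wt_outdeg /ecut splitF addrC -addrA; congr (_ + _).
  rewrite -big_split; apply: eq_bigr => e /nF1; rewrite /inA /=.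
  by case sE: (s e \in B); case tE: (t e \in B) => //;
    rewrite !(subsetP sB).
have need2 B : B \subset A ->
    need F2 s t p2 B = need F s t p B - wt (outdeg F1 h) B.
  by move=> sB; rewrite /need einn2 // wtB; clear; lia.
have wta2 B : wt a2 B = wt a B + (wt (outdeg F1 s) B + wt (outdeg F1 t) B -
    wt (outdeg F1 h) B).
  by rewrite -wtD -wtB -wtD.
have wtb2 B : wt b2 B = wt b B + wt (outdeg F1 h) B by rewrite -wtD.
have ecutA : ecut F2 s t A = 0.
  by apply: big1 => e /iF2/andP[-> ->].
have [] := IH A F2 s t p2 a2 b2 (X :&: A).
- have: (#|F2| <= #|F|)%N by apply/subset_leq_card/subsetP.
  have := proper_card pA; clear; lia.
- split.
  + by move=> e /iF2.
  + move=> x; rewrite /a2; apply: addr_ge0 => //.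
    rewrite /outdeg -big_split -sumrB /=; apply: sumr_ge0 => e _.
    by case: (hst e) => ->; do 2 case: (_ == x).
  + by move=> x; rewrite /b2; apply: addr_ge0 => //; apply: sumr_ge0.
  + exists (- jO); rewrite need2 // wt_outdeg -OE HO /p1 /col eqxx; clear; lia.
  + have := ecut2 A (subxx _); rewrite ecutA wta2 wtb2.
    rewrite [wt (outdeg F1 h) A]wt_outdeg -OE.
    have aA := wt_ge0 A a0; have bA := wt_ge0 A b0.
    (* The out-flow O of [A] is congruent to its requirement, so neither O nor O + m nor O - m lies
       in the shrunken interval. For O this bounds [wt a2 A] or [wt b2 A] by m - 1; the two shifts
       bound [wt a2 A] and [wt b2 A] by 2m - 1. *)
    have O1 : outdeg F1 h1 r <= m - 1 - wt b A \/
              ecut F s t A + wt a A - m + 1 <= outdeg F1 h1 r.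
      have: ~ (m - wt b A <= outdeg F1 h1 r <= ecut F s t A + wt a A - m).
        move=> H; move/negP: tight; apply; apply/hitsP; exists jO.
        by move: HO; rewrite /p1 /col eqxx; lia.
      lia.
    have O2 : ~ (m - wt b A <= outdeg F1 h1 r + m <= ecut F s t A + wt a A - m).
      move=> H; move/negP: tight; apply; apply/hitsP; exists (jO + 1).
      by move: HO; rewrite /p1 /col eqxx; lia.
    have O3 : ~ (m - wt b A <= outdeg F1 h1 r - m <= ecut F s t A + wt a A - m).
      move=> H; move/negP: tight; apply; apply/hitsP; exists (jO - 1).
      by move: HO; rewrite /p1 /col eqxx; lia.
    move: O0 Ocut aA bA O1 O2 O3; move: (outdeg F1 h1 r) => O.
    rewrite !add0r; clear => O0 Ocut aA bA O1 O2 O3 H.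
    by case: O1 => ?; [right|left]; lia.
  + rewrite subsetIr /=; apply: leq_trans X1.
    by apply/subset_leq_card/subsetIl.
  + move=> x; rewrite inE => /andP[xX xA]; have [j Hj] := ex x xX.
    exists j; rewrite need2 ?sub1set // wt1; move: Hj.
    rewrite (ecut2 [set x]) ?sub1set // !wt1 /a2 /b2; clear; lia.
  + move=> B pB B0 BX; have sB := proper_sub pB.
    have /hitsP[j Hj] : cut_ok F s t p a b 0 0 B.
      apply: cU => //; first exact: proper_sub_trans pB sAU.
      apply: contra BX => /eqP <-; apply/eqP/esym/setIidPl => //.
    apply/hitsP; exists j; move: Hj; rewrite need2 // (ecut2 B) //.
    rewrite wta2 wtb2; clear; lia.
move=> h2 [h2st h2p].
have nF2 e : e \in F1 -> (e \in F2) = false.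
  by move=> /[dup] /sF1 eF /nF1/negbTE Q; rewrite inE eF Q.
exists (fun e => if e \in F2 then h2 e else h e); split.
  move=> e eF; case: ifP => // eF2; exact: h2st.
move=> x xU; rewrite /outdeg splitF.
have -> : \sum_(e in F1) ((if e \in F2 then h2 e else h e) == x)%:Z
    = outdeg F1 h x by apply: eq_bigr => e /nF2 ->.
have -> : \sum_(e in F2) ((if e \in F2 then h2 e else h e) == x)%:Z
    = outdeg F2 h2 x by apply: eq_bigr => e ->.
have [xA|xA] := boolP (x \in A).
  have [j Hj] := h2p x xA; exists j; rewrite Hj /p2; clear; lia.
have xr : x != r by apply: contra xA => /eqP ->.
have [|j Hj] := h1p x; first by rewrite !inE xA xU orbT.
exists j; rewrite [X in _ + X]big1.
  move: Hj; rewrite /p1 /col (negbTE xr) addr0 => <-.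
  apply: eq_bigr => e eF; rewrite -gh // /g.
  case hA: (h e \in A) => //; rewrite [r == x]eq_sym (negbTE xr).
  by case: eqP => // hx; rewrite -hx hA in xA.
move=> e eF2; have /andP[sA tA] := iF2 e eF2.
by case: eqP => // hx; move: xA; rewrite -hx;
  case: (h2st e eF2) => ->; rewrite ?sA ?tA.
Qed.

(** * Deleting and lifting edges *)

Definition joins s t e x y : Prop := s e = x /\ t e = y \/ s e = y /\ t e = x.

Lemma joinsC s t e x y : joins s t e x y -> joins s t e y x.
Proof. by case=> H; [right|left]. Qed.

Lemma crossing_edge F s t A : 0 < ecut F s t A ->
  exists e x y, [/\ e \in F, x \in A, y \notin A & joins s t e x y].
Proof.
move=> pos; have [/exists_inP[e eF] | /exists_inPn none] :=
    boolP [exists e in F, (s e \in A) (+) (t e \in A)].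
  case sA: (s e \in A); case tA: (t e \in A) => // _.
    by exists e, (s e), (t e); split; rewrite ?tA //; left.
  by exists e, (t e), (s e); split; rewrite ?sA //; right.
by move: pos; rewrite /ecut big1 // => e /none/negbTE ->.
Qed.

Lemma ecut_del F s t e x y A : e \in F -> joins s t e x y ->
  ecut (F :\ e) s t A = ecut F s t A - ((x \in A) (+) (y \in A))%:Z.
Proof.
move=> eF xy; rewrite {2}/ecut (big_setD1 e) //= addrC.
by case: xy => -[-> ->]; rewrite ?addrK // addbC addrK.
Qed.

Lemma einn_del F s t e x y A : e \in F -> joins s t e x y ->
  einn (F :\ e) s t A = einn F s t A - ((x \in A) && (y \in A))%:Z.
Proof.
move=> eF xy; rewrite {2}/einn (big_setD1 e) //= addrC.
by case: xy => -[-> ->]; rewrite ?addrK // andbC addrK.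
Qed.

(** The deleted edge is meant to be oriented from [x] to [y], which uses up one unit of the demand
    of [x]. *)
Lemma need_del F s t p e x y A : e \in F -> joins s t e x y ->
  need (F :\ e) s t (upd p x (-1)) A =
  need F s t p A - ((x \in A) && (y \notin A))%:Z.
Proof.
move=> eF xy; rewrite /need wt_upd (einn_del _ eF xy).
by case: (x \in A); case: (y \in A) => /=; clear; lia.
Qed.

Lemma del_step U F s t p a b X e x y :
  orientable_below (#|U| + #|F|) -> e \in F -> joins s t e x y ->
  valid U (F :\ e) s t (upd p x (-1)) a b X -> orientable U F s t p.
Proof.
move=> IH eF xy /IH[|h [hst hp]].
  by rewrite (cardsD1 e F) eF ltn_add2l.
exists (fun e' => if e' == e then x else h e'); split=> [e' e'F|v vU].
  case: eqP => [->|/eqP ne]; last by apply: hst; rewrite !inE ne.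
  by case: xy => -[-> ->]; [left|right].
have [j Hj] := hp v vU; exists j.
rewrite /outdeg (big_setD1 e) //= eqxx.
rewrite (eq_bigr (fun e' => (h e' == v)%:Z)); last first.
  by move=> e'; rewrite !inE => /andP[/negbTE ->].
move: Hj; rewrite /outdeg /upd => ->; clear; lia.
Qed.

(* Lifting replaces the edges xy and xz by one edge yz, stored in [e1]. *)
Section Lift.
Variables (F : {set E}) (s t : E -> V) (p : V -> int) (e1 e2 : E) (x y z : V).
Hypotheses (e1F : e1 \in F) (e2F : e2 \in F) (e12 : e1 != e2).
Hypotheses (xy : joins s t e1 x y) (xz : joins s t e2 x z).

Let s' e := if e == e1 then y else s e.
Let t' e := if e == e1 then z else t e.

Let sum2 (phi : E -> int) :
  \sum_(e in F) phi e = phi e1 + phi e2 + \sum_(e in F :\ e2 :\ e1) phi e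
  :> int.
Proof.
by rewrite (big_setD1 e2) //= (big_setD1 e1) ?inE ?e12 //= addrCA addrA.
Qed.

Let sum1 (phi : E -> int) :
  \sum_(e in F :\ e2) phi e = phi e1 + \sum_(e in F :\ e2 :\ e1) phi e
  :> int.
Proof. by rewrite (big_setD1 e1) ?inE ?e12. Qed.

Lemma ecut_lift A : ecut (F :\ e2) s' t' A =
  ecut F s t A - ((x \in A) (+) (y \in A))%:Z - ((x \in A) (+) (z \in A))%:Z
    + ((y \in A) (+) (z \in A))%:Z.
Proof.
rewrite /ecut sum1 sum2 /s' /t' eqxx.
rewrite (eq_bigr (fun e => ((s e \in A) (+) (t e \in A))%:Z)); last first.
  by move=> e; rewrite !inE => /andP[/negbTE -> _].
move: (\sum_(e in _ :\ _ :\ _) _) => S.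
case: xy => -[-> ->]; case: xz => -[-> ->];
by case: (x \in A); case: (y \in A); case: (z \in A); clear; lia.
Qed.

Lemma need_lift A : need (F :\ e2) s' t' (upd p x (-1)) A = need F s t p A
  + ((x \in A) && (y \in A))%:Z + ((x \in A) && (z \in A))%:Z
    - ((y \in A) && (z \in A))%:Z - (x \in A)%:Z.
Proof.
rewrite /need wt_upd /einn sum1 sum2 /s' /t' eqxx.
rewrite (eq_bigr (fun e => ((s e \in A) && (t e \in A))%:Z)); last first.
  by move=> e; rewrite !inE => /andP[/negbTE -> _].
move: (\sum_(e in _ :\ _ :\ _) _) => S.
case: xy => -[-> ->]; case: xz => -[-> ->];
by case: (x \in A); case: (y \in A); case: (z \in A); clear; lia.
Qed.

(** The oriented edge yz is rerouted as a directed path through [x]. Whichever direction it has, [x]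
    gains exactly one outgoing edge, hence the demand lowered by 1 at [x]. *)
Lemma orientable_lift U :
  orientable U (F :\ e2) s' t' (upd p x (-1)) -> orientable U F s t p.
Proof.
case=> h [hst hp].
pose o := h e1 == y.
exists (fun e => if e == e1 then if o then y else x
                 else if e == e2 then if o then x else z else h e).
split=> [e eF|v vU].
  case: eqP => [->|/eqP n1].
    by case: xy => -[-> ->]; case: ifP; [right|left|left|right].
  case: eqP => [->|/eqP n2].
    by case: xz => -[-> ->]; case: ifP; [left|right|right|left].
  by have := hst e; rewrite !inE n2 eF /s' /t' (negbTE n1); apply.
have [j Hj] := hp v vU; exists j; move: Hj.
rewrite /outdeg sum2 sum1 !eqxx [e2 == e1]eq_sym (negbTE e12).
rewrite [in X in _ -> X](eq_bigr (fun e => (h e == v)%:Z)); last first.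
  by move=> e; rewrite !inE => /andP[/negbTE -> /andP[/negbTE -> _]].
have: h e1 = if o then y else z.
  have := hst e1; rewrite !inE e12 e1F /s' /t' eqxx /o => /(_ isT).
  by case: eqP => [->|ne [//|]].
rewrite /upd => ->; move: (\sum_(e in _ :\ _ :\ _) _) => S.
case: o; clear; lia.
Qed.
End Lift.

(** * Removing a vertex with one neighbour and splitting off the exempt vertex *)

Lemma subset_of_card (T : finType) (D : {set T}) n : (n <= #|D|)%N ->
  exists2 S : {set T}, S \subset D & #|S| = n.
Proof.
move=> nD; exists [set x in take n (enum D)].
  by apply/subsetP => x; rewrite inE => /mem_take; rewrite mem_enum.
rewrite cardsE; have /card_uniqP -> : uniq (take n (enum D)).
  exact/take_uniq/enum_uniq.
by rewrite size_takel // -cardE.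
Qed.

(** Only the number of xy edges directed away from [x] matters for [x], and [o] is an admissible
    number. Fixing it, [x] is merged into [y] together with its apex edges; a set containing [y]
    then inherits the condition of the same set with [x] added. *)
Lemma absorb_step U F s t p a b X x y o :
  orientable_below (#|U| + #|F|) -> valid U F s t p a b X ->
  X \subset [set x] ->
  x \in U -> y \in U -> x != y ->
  (forall e, e \in F -> (s e == x) (+) (t e == x) -> joins s t e x y) ->
  (exists j, o = need F s t p [set x] + j * m) ->
  0 <= o <= ecut F s t [set x] -> orientable U F s t p.
Proof.
move=> IH [ends a0 b0 [j0 tot] reg _ _ cU] Xx xU yU xy only [j Ho] obnd.
pose D := [set e in F | (s e == x) (+) (t e == x)].
pose F' := [set e in F | (s e != x) && (t e != x)].
have splitF (phi : E -> int) : \sum_(e in F) phi e = \sum_(e in F') phi e +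
   \sum_(e in D) phi e + \sum_(e in F | (s e == x) && (t e == x)) phi e
   :> int.
  rewrite (bigID (fun e => (s e != x) && (t e != x))) /= -addrA.
  congr (_ + _); first by apply: eq_bigl => e; rewrite inE.
  rewrite (bigID (fun e => (s e == x) (+) (t e == x))) /=; congr (_ + _).
    apply: eq_bigl => e; rewrite inE; case: (e \in F) => //=.
    by do 2 case: (_ == x).
  by apply: eq_bigl => e; case: (e \in F) => //=; do 2 case: (_ == x).
have nF' e : e \in F' -> [/\ e \in F, s e != x & t e != x].
  by rewrite inE => /and3P[].
have jD e : e \in D -> joins s t e x y.
  by rewrite inE => /andP[eF]; apply: only.
have ecutx : ecut F s t [set x] = #|D|%:Z.
  rewrite /ecut splitF big1 ?add0r; last first.
    by move=> e /nF'[_ /negbTE sx /negbTE tx]; rewrite !inE sx tx.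
  rewrite [X in _ + X]big1 ?addr0; last first.
    by move=> e /andP[_ /andP[sx tx]]; rewrite !inE sx tx.
  rewrite (eq_bigr (fun=> 1)); first by rewrite sumr_const natz.
  by move=> e; rewrite !inE => /andP[_ ->].
have einnx : einn F s t [set x] =
    \sum_(e in F | (s e == x) && (t e == x)) 1.
  rewrite /einn splitF big1 ?add0r; last first.
    by move=> e /nF'[_ /negbTE sx /negbTE tx]; rewrite !inE sx tx.
  rewrite big1 ?add0r; last first.
    by move=> e; rewrite !inE => /andP[_]; do 2 case: (_ == x).
  by apply: eq_bigr => e /andP[_ /andP[sx tx]]; rewrite !inE sx tx.
(* The remaining [ecut F s t [set x] - o] parallel edges have tail [y] and are charged to its
   demand. *)
pose p' := upd p y (o - ecut F s t [set x]).
have ecut0 B : x \notin B -> y \notin B -> ecut F' s t B = ecut F s t B.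
  move=> xB yB; rewrite {2}/ecut splitF [X in _ = _ + X + _]big1 ?addr0.
    rewrite [X in _ = _ + X]big1 ?addr0 // => e /andP[_ /andP[/eqP-> /eqP->]].
    by rewrite (negbTE xB).
  by move=> e /jD[] [-> ->]; rewrite (negbTE xB) (negbTE yB).
have einn0 B : x \notin B -> einn F' s t B = einn F s t B.
  move=> xB; rewrite {2}/einn splitF [X in _ = _ + X + _]big1 ?addr0.
    rewrite [X in _ = _ + X]big1 ?addr0 // => e /andP[_ /andP[/eqP-> /eqP->]].
    by rewrite (negbTE xB).
  by move=> e /jD[] [-> ->]; rewrite (negbTE xB) ?andbF.
have inU1 B v : v != x -> (v \in x |: B) = (v \in B).
  by move=> vx; rewrite !inE (negbTE vx).
have ecut1 B : x \notin B -> y \in B -> ecut F' s t B = ecut F s t (x |: B).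
  move=> xB yB; rewrite {2}/ecut splitF [X in _ = _ + X + _]big1 ?addr0.
    rewrite [X in _ = _ + X]big1 ?addr0 => [|e /andP[_ /andP[/eqP-> /eqP->]]].
      by apply: eq_bigr => e /nF'[_ sx tx]; rewrite !inU1.
    by rewrite !inE eqxx.
  by move=> e /jD[] [-> ->]; rewrite !inE eqxx yB orbT.
have einn1 B : x \notin B -> y \in B ->
    einn F s t (x |: B) = einn F' s t B + ecut F s t [set x]
                          + einn F s t [set x].
  move=> xB yB; rewrite ecutx einnx /einn splitF; congr (_ + _ + _).
  - by apply: eq_bigr => e /nF'[_ sx tx]; rewrite !inU1.
  - rewrite (eq_bigr (fun=> 1)) ?sumr_const ?natz //.
    by move=> e /jD[] [-> ->]; rewrite !inE eqxx yB orbT.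
  - by apply: eq_bigr => e /andP[_ /andP[/eqP-> /eqP->]]; rewrite !inE eqxx.
have wtU f B : x \notin B -> wt f (x |: B) = f x + wt f B.
  by move=> xB; rewrite /wt big_setU1.
have need0 B : x \notin B -> y \notin B -> need F' s t p' B = need F s t p B.
  move=> xB yB; rewrite /need einn0 // wt_upd (negbTE yB); clear; lia.
have need1 B : x \notin B -> y \in B ->
    need F' s t p' B = need F s t p (x |: B) + j * m.
  move=> xB yB; move: Ho; rewrite /need wtU // einn1 // wt_upd yB wt1.
  by clear; lia.
have UE : x |: (U :\ x) = U by rewrite setD1K.
have yU' : y \in U :\ x by rewrite !inE eq_sym xy.
have xU' : x \notin U :\ x by rewrite !inE eqxx.
have wtU' f : wt (upd f y (f x)) (U :\ x) = wt f U.
  by rewrite wt_upd yU'; have := wtU f _ xU'; rewrite UE => ->; clear; lia.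
have [] := IH (U :\ x) F' s t p' (upd a y (a x)) (upd b y (b x)) set0.
- have: (#|F'| <= #|F|)%N by apply/subset_leq_card/subsetP => e /nF'[].
  by rewrite (cardsD1 x U) xU; clear; lia.
- split.
  + by move=> e /nF'[/ends/andP[sU tU] sx tx]; rewrite !inE sx tx sU tU.
  + move=> v; have := a0 v; have := a0 x; rewrite /upd; case: eqP; clear; lia.
  + move=> v; have := b0 v; have := b0 x; rewrite /upd; case: eqP; clear; lia.
  + exists (j0 + j); rewrite need1 // UE tot; clear; lia.
  + by rewrite !wtU'.
  + by rewrite sub0set cards0.
  + by move=> v; rewrite inE.
  + move=> B pB B0 _; have sB := proper_sub pB.
    have xB : x \notin B by apply: contra xU'; apply: (subsetP sB).
    have [yB|yB] := boolP (y \in B).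
      have: cut_ok F s t p a b 0 0 (x |: B).
        apply: cU.
        * rewrite -UE properE setUS //=; apply: contraL pB => H.
          rewrite properE sB /= negbK; apply/subsetP => v vU.
          have: v \in x |: B by apply: (subsetP H); rewrite inE vU orbT.
          by move: vU; rewrite !inE => /andP[/negbTE ->].
        * by apply/set0Pn; exists x; rewrite !inE eqxx.
        * apply: contra xy => /eqP XE; move: (subsetP Xx y).
          by rewrite -XE !inE yB orbT eq_sym => ->.
      case/hitsP => i Hi; apply/hitsP; exists (i - j); move: Hi.
      rewrite need1 // ecut1 // !wt_upd yB !wtU //; clear; lia.
    suff: cut_ok F s t p a b 0 0 B.
      case/hitsP => i Hi; apply/hitsP; exists i; move: Hi.
      rewrite need0 // ecut0 // !wt_upd (negbTE yB); clear; lia.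
    apply: (cU _ _ B0); first exact: proper_sub_trans pB (subD1set _ _).
    have [v vB] := set0Pn _ B0; apply: contra xB => /eqP BX.
    by move: (subsetP Xx v); rewrite -BX vB inE => /(_ isT)/eqP <-.
move=> h [hst hp].
have [S SD Scard] : exists2 S : {set E}, S \subset D & #|S|%:Z = o.
  have [|S SD cS] := @subset_of_card E D `|o|%N.
    by move: obnd; rewrite ecutx; clear; lia.
  by exists S => //; move: obnd; rewrite cS; clear; lia.
(* The last default [x] serves both the edges of [S] and the loops at [x]. *)
pose h' e := if e \in F' then h e else if e \in D :\: S then y else x.
have h'F e : e \in F' -> h' e = h e by rewrite /h' => ->.
have h'D e : e \in D -> h' e = if e \in S then x else y.
  move=> eD; rewrite /h' ifN; first by rewrite inE eD andbT; case: (e \in S).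
  move: eD; rewrite !inE; case: (e \in F) => //=; by do 2 case: (_ == x).
have h'L e : (s e == x) && (t e == x) -> h' e = x.
  by move=> /andP[sx tx]; rewrite /h' !inE sx tx !andbF.
exists h'; split=> [e eF|v vU].
  have [eF'|eF'] := boolP (e \in F'); first by rewrite h'F //; exact: hst.
  have [eD|eD] := boolP (e \in D).
    rewrite h'D //; case: (jD e eD) => -[-> ->]; case: ifP => _;
    by [left|right].
  have sx : (s e == x) && (t e == x).
    by move: eF' eD; rewrite !inE eF /=; do 2 case: (_ == x).
  by rewrite h'L //; case/andP: sx => /eqP-> _; left.
have sumD (c1 c2 : int) : \sum_(e in D) (if e \in S then c1 else c2) =
    o * c1 + (ecut F s t [set x] - o) * c2.
  rewrite (bigID (mem S)) /=.
  rewrite (eq_bigr (fun=> c1)); last by move=> e /andP[_ ->].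
  rewrite [X in _ + X](eq_bigr (fun=> c2)); last by move=> e /andP[_ /negbTE->].
  rewrite !sumr_const (pmulrn c1) (pmulrn c2) !mulrzz.
  have -> : #|[pred i | (i \in D) && (i \in S)]| = #|S|.
    by apply: eq_card => e; rewrite inE andbC; case eS: (e \in S) => //=;
      rewrite (subsetP SD).
  have -> : #|[pred i | (i \in D) && (i \notin S)]| = #|D :\: S|.
    by apply: eq_card => e; rewrite !inE andbC.
  rewrite -Scard ecutx -(cardsID S D) (setIidPr SD) PoszD.
  by clear; lia.
have Dsum : \sum_(e in D) (h' e == v)%:Z =
    o * (x == v)%:Z + (ecut F s t [set x] - o) * (y == v)%:Z.
  by rewrite -sumD; apply: eq_bigr => e eD; rewrite h'D //; case: ifP.
have Lsum : \sum_(e in F | (s e == x) && (t e == x)) (h' e == v)%:Z =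
    einn F s t [set x] * (x == v)%:Z.
  rewrite einnx mulr_suml; apply: eq_bigr => e /andP[_ /h'L ->].
  by rewrite mul1r.
rewrite /outdeg splitF Dsum Lsum (eq_bigr (fun e => (h e == v)%:Z)); last first.
  by move=> e /h'F ->.
have [xv|xv] := eqVneq x v.
  exists j; rewrite big1 => [|e eF'].
    rewrite -xv eq_sym (negbTE xy); move: Ho; rewrite /need wt1; clear; lia.
  have [eF sx tx] := nF' e eF'; rewrite -xv.
  by case: (hst e eF') => ->; rewrite ?(negbTE sx) ?(negbTE tx).
have [|i Hi] := hp v; first by rewrite !inE eq_sym xv.
exists i; move: Hi; rewrite /outdeg /p' /upd => ->; clear; lia.
Qed.

(* The exempt vertex [x] is split off by lifting its apex edges, then pairs of
   its other edges, until it is isolated or has a single neighbour. *)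
Lemma exempt_step U F s t p a b x :
  orientable_below (#|U| + #|F|) -> valid U F s t p a b [set x] ->
  (2 <= #|U|)%N ->
  orientable U F s t p.
Proof.
move=> IH val U2.
have [/existsP[A /and3P[pA A2 tA]]|/existsPn none] := boolP
    [exists A : {set V}, [&& A \proper U, (2 <= #|A|)%N
                           & ~~ cut_ok F s t p a b 1 1 A]].
  exact: contract_step IH val pA A2 tA.
have C1 A : A \proper U -> (2 <= #|A|)%N -> cut_ok F s t p a b 1 1 A.
  by move=> pA A2; have := none A; rewrite pA A2 /= negbK.
case: (val) => ends a0 b0 [j0 tot] reg /andP[XU X1] ex cU.
have xU : x \in U by rewrite -sub1set.
have [j Hj] := ex x (set11 x).
have C1x A : A \proper U -> A != [set x] -> x \in A -> cut_ok F s t p a b 1 1 A.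
  move=> pA AX xA; apply: C1 => //; rewrite (cardsD1 x A) xA ltnS.
  apply/card_gt0P/set0Pn; apply: contra AX => /eqP A0.
  by rewrite -(setD1K xA) A0 setU0.
have [y0 y0U y0x] : exists2 y, y \in U & x != y.
  have /card_gt0P[y] : (0 < #|U :\ x|)%N.
    by move: U2; rewrite (cardsD1 x U) xU.
  by rewrite !inE => /andP[yx yU]; exists y; rewrite // eq_sym.
(* This leaves a non-apex edge at [x] to pair with each apex edge. As the net out-flow of [x] is 0,
   the condition at [U :\ x] gives the bound: if the residues chosen on the two sides match, it
   follows from one of [wt a U], [wt b U] being at most m - 1; if they differ by a nonzero multiple
   of [m], from both being at most 2m - 1. *)
have bound : a x + b x <= ecut F s t [set x].
  have /hitsP[i] : cut_ok F s t p a b 0 0 (U :\ x).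
    apply: cU.
    - by rewrite properD1.
    - by apply/set0Pn; exists y0; rewrite !inE eq_sym y0x.
    - by apply/eqP => /setP/(_ x); rewrite !inE eqxx.
  have := needC p ends XU; rewrite ecutC // tot.
  have := wtID a XU; have := wtID b XU; rewrite !wt1.
  move: reg Hj; move: (need _ _ _ _ (_ :\ _)) (need _ _ _ _ [set x]) => n1 n2.
  move: (wt a (_ :\ _)) (wt b (_ :\ _)) (ecut _ _ _ _) => a1 b1 c.
  move: (wt a U) (wt b U) (a x) (b x) => P Q ax bx.
  move=> reg Hj HQ HP tot' Hi.
  have : (i + j0 + j = 0 \/ m <= (i + j0 + j) * m
          \/ (i + j0 + j) * m <= - m).
    have [l1|l1|l1] := ltgtP (i + j0 + j) 0; last by left.
      by right; right; move: m_ge3 l1; clear; nia.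
    by right; left; move: m_ge3 l1; clear; nia.
  have tot2 : n1 + i * m = c - (n2 + j * m) + (i + j0 + j) * m.
    by move: tot'; clear; lia.
  move: m_ge3 reg Hj Hi HQ HP; rewrite tot2; move: (n2 + j * m) => o.
  move: (i + j0 + j) => l; clear => m3 reg Hj Hi HQ HP [l0|l0].
    by move: Hi; rewrite l0 mul0r; lia.
  by move: (l * m) Hi l0 => L; lia.
have jU e y z : e \in F -> joins s t e y z -> (y \in U) && (z \in U).
  by move=> /ends/andP[sU tU] [] [<- <-]; rewrite sU tU.
have del_ends e e' : e' \in F :\ e -> (s e' \in U) && (t e' \in U).
  by rewrite inE => /andP[_ /ends].
have nbr : 0 < ecut F s t [set x] ->
    exists e y, [/\ e \in F, x != y, y \in U & joins s t e x y].
  move=> /crossing_edge[e [x' [y [eF]]]]; rewrite !inE => /eqP-> yx ej.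
  by exists e, y; split; rewrite 1?eq_sym //; case/andP: (jU _ _ _ eF ej).
have [ax|ax] := ltrP 0 (a x).
  have [|e [y [eF xy yU ej]]] := nbr.
    by have := b0 x; move: ax bound; clear; lia.
  (* The path z0 -> x -> y is replaced by an apex edge z0 -> y. *)
  apply: (del_step (a := upd (upd a x (-1)) y 1) (b := b) (X := [set x])
            IH eF ej); split=> //.
  - exact: del_ends.
  - move=> v; have := a0 v; move: ax; rewrite /upd.
    by case: (x =P v) => [<-|_]; case: (y == _); clear; lia.
  - by exists j0; rewrite (need_del _ _ eF ej) tot yU andbF; clear; lia.
  - by move: reg; rewrite !wt_upd xU yU; clear; lia.
  - by apply/andP.
  - move=> v; rewrite inE => /eqP->; exists j.
    rewrite (need_del _ _ eF ej) (ecut_del _ eF ej) /upd !inE.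
    rewrite eqxx [y == x]eq_sym (negbTE xy) /=.
    by move: Hj; clear; lia.
  - move=> A pA A0 AX; have C0A := cU A pA A0 AX.
    have C1A := C1x A pA AX.
    have : cut_ok F s t p a b ((x \in A) && (y \notin A))%:Z
              ((x \in A) && (y \notin A))%:Z A.
      by move: C1A; case: (x \in A); case: (y \in A) => //=; apply.
    case/hitsP => i Hi; apply/hitsP; exists i; move: Hi.
    rewrite (need_del _ _ eF ej) (ecut_del _ eF ej) !wt_upd.
    by case: (x \in A); case: (y \in A) => /=; clear; lia.
have [bx|bx] := ltrP 0 (b x).
  have [|e [y [eF xy yU ej]]] := nbr.
    by have := a0 x; move: bx bound; clear; lia.
  have ej' := joinsC ej.
  (* Symmetrically, y -> x -> z0 is replaced by y -> z0. *)
  apply: (del_step (a := a) (b := upd (upd b x (-1)) y 1) (X := [set x])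
            IH eF ej'); split=> //.
  - exact: del_ends.
  - move=> v; have := b0 v; move: bx; rewrite /upd.
    by case: (x =P v) => [<-|_]; case: (y == _); clear; lia.
  - by exists j0; rewrite (need_del _ _ eF ej') tot xU andbF; clear; lia.
  - by move: reg; rewrite !wt_upd xU yU; clear; lia.
  - by apply/andP.
  - move=> v; rewrite inE => /eqP->; exists j.
    rewrite (need_del _ _ eF ej') (ecut_del _ eF ej') /upd !inE.
    rewrite eqxx [y == x]eq_sym (negbTE xy) /=.
    by move: Hj; clear; lia.
  - move=> A pA A0 AX; have C0A := cU A pA A0 AX.
    have C1A := C1x A pA AX.
    have : cut_ok F s t p a b ((x \in A) && (y \notin A))%:Z
              ((x \in A) && (y \notin A))%:Z A.
      by move: C1A; case: (x \in A); case: (y \in A) => //=; apply.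
    case/hitsP => i Hi; apply/hitsP; exists i; move: Hi.
    rewrite (need_del _ _ eF ej') (ecut_del _ eF ej') !wt_upd.
    by case: (x \in A); case: (y \in A) => /=; clear; lia.
have ax0 : a x = 0 by apply/eqP; rewrite eq_le ax a0.
have bx0 : b x = 0 by apply/eqP; rewrite eq_le bx b0.
rewrite ax0 bx0 subr0 addr0 in Hj.
have c0 := ecut_ge0 F s t [set x].
(* Without apex edges at [x], zero net out-flow means that exactly half of its cut edges leave
   it. *)
have absorb y : y \in U -> x != y ->
    (forall e, e \in F -> (s e == x) (+) (t e == x) -> joins s t e x y) ->
    orientable U F s t p.
  move=> yU xy only.
  apply: (absorb_step IH val (subxx _) xU yU xy only
            (o := need F s t p [set x] + j * m)); first by exists j.
  by move: Hj c0; clear; lia.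
have [c_pos|c_le0] := ltrP 0 (ecut F s t [set x]); last first.
  apply: (absorb _ y0U y0x) => e eF cross.
  have : 0 < ecut F s t [set x].
    rewrite /ecut (big_setD1 e) //= !inE cross ltr_pwDl //.
    exact: sumr_ge0.
  by rewrite ltNge c_le0.
have [e [y [eF xy yU ej]]] := nbr c_pos.
have [/exists_inP[e' e'F]|/exists_inPn only] := boolP [exists e' in F,
    ((s e' == x) (+) (t e' == x)) && (s e' != y) && (t e' != y)]; last first.
  apply: (absorb _ yU xy) => e' e'F cross; have := only e' e'F.
  rewrite cross /= negb_and !negbK => /orP[] /eqP st;
    move: cross; rewrite st [y == x]eq_sym (negbTE xy) ?addbF ?addFb.
    by move=> /eqP; right.
  by move=> /eqP; left.
move=> /andP[/andP[cross sy] ty].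
have [z [ej' zx zy zU]] : exists z,
    [/\ joins s t e' x z, z != x, z != y & z \in U].
  have /andP[sU tU] := ends e' e'F; move: cross.
  have [sx|sx] := eqVneq (s e') x; have [tx|tx] := eqVneq (t e') x => // _.
    by exists (t e'); split=> //; left.
  by exists (s e'); split=> //; right.
have ee' : e != e'.
  apply: contraNneq zy => ee; move: ej ej'; rewrite ee.
  case=> -[E1 E2] [[E3 E4]|[E3 E4]].
  - by rewrite -E4 E2.
  - by move: xy; rewrite -E2 E4 eqxx.
  - by move: xy; rewrite -E1 E3 eqxx.
  - by rewrite -E3 E1.
apply: (orientable_lift eF e'F ee' ej ej').
apply: (IH _ _ _ _ _ a b [set x]).
  by rewrite (cardsD1 e' F) e'F ltn_add2l.
split=> //.
- move=> e1; rewrite !inE => /andP[_ /ends/andP[sU tU]].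
  by case: ifP => _; rewrite ?sU ?tU ?yU ?zU.
- exists j0; rewrite (need_lift _ eF e'F ee' ej ej') tot xU yU zU.
  by clear; lia.
- by apply/andP.
- move=> v; rewrite inE => /eqP ->; exists j.
  rewrite (need_lift _ eF e'F ee' ej ej') (ecut_lift eF e'F ee' ej ej') !inE.
  rewrite eqxx [y == x]eq_sym (negbTE xy) (negbTE zx) ax0 bx0.
  by move: Hj; clear; lia.
- move=> A pA A0 AX; have C0A := cU A pA A0 AX.
  have C1A := C1x A pA AX.
  have C1yz : y \in A -> z \in A -> cut_ok F s t p a b 1 1 A.
    move=> yA zA; apply: C1 => //; rewrite (cardsD1 y A) yA ltnS.
    by apply/card_gt0P; exists z; rewrite !inE zy.
  (* Lifting shrinks the cut, by 2, only when [A] separates [x] from both [y] and [z]. Such an [A],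
     not being [[set x]], has two vertices, so its condition has slack 1 at each end to pay for the
     loss. *)
  pose d := ((y \in A) (+) (x \in A)) && ((z \in A) (+) (x \in A)).
  have : cut_ok F s t p a b d%:Z d%:Z A.
    move: C1A C1yz; rewrite /d.
    by case: (x \in A); case: (y \in A); case: (z \in A) => //= H1 H2;
      [apply: H1|apply: H2].
  case/hitsP => i Hi; apply/hitsP; exists i; move: Hi.
  rewrite (need_lift _ eF e'F ee' ej ej') (ecut_lift eF e'F ee' ej ej') /d.
  by case: (x \in A); case: (y \in A); case: (z \in A) => /=; clear; lia.
Qed.

(** * Pinned vertices *)

Lemma cut_ok_weak F s t p a b d1 d2 d1' d2' A : d1' <= d1 -> d2' <= d2 ->
  cut_ok F s t p a b d1 d2 A -> cut_ok F s t p a b d1' d2' A.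
Proof.
move=> H1 H2 /hitsP[i Hi]; apply/hitsP; exists i.
by move: H1 H2 Hi; clear; lia.
Qed.

(** The intervals of [A] and [U :\: A] are nonempty, so 4(m - 1) is at most twice the cut plus the
    number of apex edges, and [v_reg] allows at most 3m - 2 of the latter. *)
Lemma connected U F s t p a b A : valid U F s t p a b set0 ->
  A \proper U -> A != set0 -> 0 < ecut F s t A.
Proof.
move=> [ends a0 b0 [j0 tot] reg _ _ cU] pA A0.
have sAU := proper_sub pA.
have /hitsP[i Hi] := cU A pA A0 A0.
have DA0 : U :\: A != set0 by rewrite setD_eq0; case/andP: pA.
have /hitsP[i' Hi'] : cut_ok F s t p a b 0 0 (U :\: A).
  apply: cU => //; rewrite properE subsetDl.
  have [v vA] := set0Pn _ A0; apply/subsetPn; exists v.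
    exact: (subsetP sAU).
  by rewrite inE vA.
move: Hi Hi' reg; rewrite (ecutC _ ends) (wtID a sAU) (wtID b sAU).
by move: m_ge3; clear; lia.
Qed.

(** Every vertex is pinned at the upper end and not at the lower one: the upper end is the only
    admissible value of its interval, and the interval has more than one element. *)
Definition upper_only U F s t p a b := forall x, x \in U ->
  cut_ok F s t p a b 1 0 [set x] && ~~ cut_ok F s t p a b 0 1 [set x].

Definition lower_only U F s t p a b := forall x, x \in U ->
  cut_ok F s t p a b 0 1 [set x] && ~~ cut_ok F s t p a b 1 0 [set x].

Lemma proper1 U x : (2 <= #|U|)%N -> x \in U -> [set x] \proper U.
Proof. by move=> U2 xU; rewrite properEcard sub1set xU cards1. Qed.

Lemma set1_neq0 x : [set x] != set0.
Proof. by apply/set0Pn; exists x; rewrite inE. Qed.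

Lemma one_sided U F s t p a b :
  orientable_below (#|U| + #|F|) -> valid U F s t p a b set0 -> (3 <= #|U|)%N ->
  orientable U F s t p \/
  (forall A, A \proper U -> (2 <= #|A|)%N -> cut_ok F s t p a b 1 1 A) /\
  (lower_only U F s t p a b \/ upper_only U F s t p a b).
Proof.
move=> IH val U3; have U2 := ltnW U3.
have [/existsP[A /and3P[pA A2 tA]]|/existsPn none] := boolP
    [exists A : {set V}, [&& A \proper U, (2 <= #|A|)%N
                           & ~~ cut_ok F s t p a b 1 1 A]].
  by left; exact: contract_step IH val pA A2 tA.
have C1 A : A \proper U -> (2 <= #|A|)%N -> cut_ok F s t p a b 1 1 A.
  by move=> pA A2; have := none A; rewrite pA A2 /= negbK.
case: (val) => ends a0 b0 tot reg XU _ cU.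
have C0 A : A \proper U -> A != set0 -> cut_ok F s t p a b 0 0 A.
  by move=> pA A0; apply: cU.
pose NL x := cut_ok F s t p a b 1 0 [set x].
pose NU x := cut_ok F s t p a b 0 1 [set x].
(* When the admissible value is both ends of the interval, its double is their sum [ecut + a - b],
   so [x] qualifies as the exempt vertex. *)
have [/exists_inP[x xU /andP[nl nu]]|/exists_inPn noZ] := boolP
    [exists x in U, ~~ NL x && ~~ NU x].
  left; apply: (exempt_step (a := a) (b := b) (x := x) IH _ U2); split=> //.
  - by rewrite sub1set xU cards1.
  - move=> v; rewrite inE => /eqP ->.
    have /hitsP[i Hi] := C0 _ (proper1 U2 xU) (set1_neq0 x); exists i.
    move: Hi; rewrite !wt1 => Hi.
    have /hitsP nl' := nl; have /hitsP nu' := nu.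
    have {nl'} n1 : ~ (m - 1 - b x + 1 <= need F s t p [set x] + i * m <=
               ecut F s t [set x] + a x - (m - 1) - 0).
      by move=> H; apply: nl'; exists i; rewrite !wt1.
    have {nu'} n2 : ~ (m - 1 - b x + 0 <= need F s t p [set x] + i * m <=
               ecut F s t [set x] + a x - (m - 1) - 1).
      by move=> H; apply: nu'; exists i; rewrite !wt1.
    by move: n1 n2 Hi; clear; lia.
  - by move=> A pA A0 _; apply: C0.
have delete e x y : e \in F -> joins s t e x y -> x != y -> NL x -> NU y ->
    orientable U F s t p.
  move=> eF ej xy nlx nuy.
  have /andP[xU yU] : (x \in U) && (y \in U).
    by have /andP[sU tU] := ends e eF; case: ej => -[<- <-]; rewrite sU tU.
  apply: (del_step (a := a) (b := b) (X := set0) IH eF ej); split=> //.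
  - by move=> e'; rewrite inE => /andP[_ /ends].
  - have [j0 tot0] := tot; exists j0.
    by rewrite (need_del _ _ eF ej) tot0 yU andbF subr0.
  - by move=> v; rewrite inE.
  - move=> A pA A0 _.
    (* Deleting x -> y costs 1 at the lower end if [A] contains only [x], and 1 at the upper end if
       it contains only [y]. Larger sets have slack at both ends, so only the singletons [x] and [y]
       need their own hypotheses. *)
    have: cut_ok F s t p a b ((x \in A) && (y \notin A))%:Z
                          ((y \in A) && (x \notin A))%:Z A.
      have [A2|A1] := ltnP 1 #|A|.
        by apply: cut_ok_weak (C1 A pA A2); case: (_ && _).
      have /cards1P[z Az] : #|A| == 1 by rewrite eqn_leq A1 card_gt0.
      rewrite Az !inE; have [xz|_] := eqVneq x z.
        by rewrite -xz andbF; apply: cut_ok_weak nlx => //; case: (_ && _).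
      have [yz|_] := eqVneq y z; first by rewrite -yz.
      by apply: C0; rewrite -Az.
    case/hitsP => i Hi; apply/hitsP; exists i; move: Hi.
    rewrite (need_del _ _ eF ej) (ecut_del _ eF ej).
    by case: (x \in A); case: (y \in A) => /=; clear; lia.
have [/exists_inP[e eF]|/exists_inPn nodel] := boolP [exists e in F,
    (s e != t e) && (NL (s e) && NU (t e) || NL (t e) && NU (s e))].
  case/andP => st /orP[] /andP[nl nu]; left.
    by apply: (delete e (s e) (t e)) => //; left.
  by apply: (delete e (t e) (s e)) => //; [right|rewrite eq_sym].
have nd e x y : e \in F -> joins s t e x y -> x != y -> ~~ (NL x && NU y).
  move=> eF ej xy; have := nodel e eF.
  by case: ej => -[-> ->]; rewrite ?[y == x]eq_sym xy negb_or => /andP[].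
have someside x : x \in U -> NL x || NU x.
  by move=> /noZ; rewrite negb_and !negbK.
right; split=> //.
(* [W] collects the vertices pinned at the lower end. An edge between [W] and the rest could be
   deleted, so by connectivity [W] is empty or all of [U]. *)
pose W := [set x in U | ~~ NL x].
have WU : W \subset U by apply/subsetP => x; rewrite inE => /andP[].
have [W0|W0] := eqVneq W set0.
  have nlx x : x \in U -> NL x.
    by move=> xU; have := in_set0 x; rewrite -W0 inE xU => /negbFE.
  right=> x xU; rewrite -/(NL x) -/(NU x) nlx //=.
  have := connected val (proper1 U2 xU) (set1_neq0 x).
  case/crossing_edge => e [x' [y [eF]]]; rewrite !inE => /eqP -> yx ej.
  have := nd e y x eF (joinsC ej) yx; rewrite nlx //.
  by have /andP[sU tU] := ends e eF; case: ej => [[_ <-]|[<- _]].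
have [WeU|WnU] := eqVneq W U.
  left=> x xU; rewrite -/(NL x) -/(NU x).
  have: x \in W by rewrite WeU.
  rewrite inE => /andP[_ nl]; have := someside x xU.
  by rewrite (negbTE nl) /= => ->.
have pW : W \proper U by rewrite properEneq WnU.
have /crossing_edge[e [x [y [eF xW yW ej]]]] := connected val pW W0.
have yx : y != x by apply: contra yW => /eqP ->.
have := nd e y x eF (joinsC ej) yx.
have /andP[xU yU] : (x \in U) && (y \in U).
  by have /andP[sU tU] := ends e eF; case: ej => -[<- <-]; rewrite sU tU.
move: xW yW; rewrite !inE xU yU /= negbK => nlx ->.
by have := someside x xU; rewrite (negbTE nlx) /= => ->.
Qed.

(** The interval at [x] has at least two elements, and at most [m] because its upper end is the only
    member of its residue class there. *)
Lemma upper_only_bounds U F s t p a b x :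
  upper_only U F s t p a b -> x \in U ->
  2 * m - 1 <= ecut F s t [set x] + a x + b x <= 3 * m - 3.
Proof.
move=> uo /uo/andP[/hitsP[i Hi] /hitsP nu]; move: Hi; rewrite !wt1 => Hi.
have n1 k : ~ (m - 1 - b x + 0 <= need F s t p [set x] + k * m <=
               ecut F s t [set x] + a x - (m - 1) - 1).
  by move=> H; apply: nu; exists k; rewrite !wt1.
have := n1 i; have := n1 (i - 1); move: Hi; rewrite mulrBl mul1r.
by move: m_ge3; clear; lia.
Qed.

(* Raising [b y] by 1, using spare room in [v_reg] or at the expense of another
   vertex, only relaxes the condition at [y]. *)
Lemma grow_lower U F s t p a y n :
  orientable_below (#|U| + #|F|) -> (3 <= #|U|)%N ->
  y \in U -> forall b, 3 * m - b y <= n%:Z ->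
  valid U F s t p a b set0 -> upper_only U F s t p a b ->
  (forall A, A \proper U -> (2 <= #|A|)%N -> cut_ok F s t p a b 1 1 A) ->
  orientable U F s t p \/ exists b', [/\ valid U F s t p a b' set0,
    upper_only U F s t p a b',
    forall A, A \proper U -> (2 <= #|A|)%N -> cut_ok F s t p a b' 1 1 A,
    forall w, w \in U -> w != y -> b' w = 0 & m - 1 <= b' y].
Proof.
move=> IH U3 yU; elim: n => [|n IHn] b bn val uo C1.
  have := upper_only_bounds uo yU; have := v_a val y.
  by have := ecut_ge0 F s t [set y]; move: bn; clear; lia.
case: (val) => ends a0 b0 tot reg _ _ cU.
have next b' : (forall x, 0 <= b' x) -> b' y = b y + 1 ->
    (wt a U <= m - 1 /\ wt b' U <= 2 * m - 1 \/
     wt a U <= 2 * m - 1 /\ wt b' U <= m - 1) ->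
    (forall A, wt b A - 1 <= wt b' A) ->
    orientable U F s t p \/ exists b', [/\ valid U F s t p a b' set0,
    upper_only U F s t p a b',
    forall A, A \proper U -> (2 <= #|A|)%N -> cut_ok F s t p a b' 1 1 A,
    forall w, w \in U -> w != y -> b' w = 0 & m - 1 <= b' y].
  move=> b'0 b'y reg' b'A.
  have val' : valid U F s t p a b' set0.
    split=> //; first by rewrite sub0set cards0.
      by move=> x; rewrite inE.
    move=> A pA A0 _.
    (* Passing to [b'] raises a lower end by at most 1, and every set has that much slack there:
       singletons by [upper_only], larger sets by [C1]. *)
    have: cut_ok F s t p a b 1 0 A.
      have [A2|A1] := ltnP 1 #|A|; first exact: cut_ok_weak (C1 A pA A2).
      have /cards1P[z Az] : #|A| == 1 by rewrite eqn_leq A1 card_gt0.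
      rewrite Az; have := uo z; rewrite (subsetP (proper_sub pA)) ?Az ?inE //.
      by move=> /(_ isT)/andP[].
    case/hitsP => i Hi; apply/hitsP; exists i; move: Hi (b'A A).
    by clear; lia.
  have [|[C1' [lo|uo']]] := one_sided IH val' U3; first by left.
    (* The lower end at [y] has moved down, so [y] cannot have become pinned there. *)
    have /andP[_ /hitsP[]] := lo y yU.
    have /andP[/hitsP[i Hi] _] := uo y yU; exists i; move: Hi b'y.
    by rewrite !wt1; clear; lia.
  by apply: (IHn b') => //; move: bn b'y; clear; lia.
have updA c A : wt (upd b y c) A = wt b A + c * (y \in A)%:Z by exact: wt_upd.
have [room|noroom] := boolP ((wt a U <= 2 * m - 1) && (wt b U <= m - 2) ||
                             (wt a U <= m - 1) && (wt b U <= 2 * m - 2)).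
  apply: (next (upd b y 1)).
  - by move=> x; have := b0 x; rewrite /upd; clear; lia.
  - by rewrite /upd eqxx; clear; lia.
  - by move: room; rewrite updA yU; clear; lia.
  - by move=> A; rewrite updA; clear; lia.
have [/exists_inP[w wU /andP[wy bw]]|/exists_inPn none] := boolP
    [exists w in U, (w != y) && (0 < b w)].
  apply: (next (upd (upd b y 1) w (-1))).
  - move=> x; have := b0 x; move: bw; rewrite /upd.
    by case: (w =P x) => [->|_]; clear; lia.
  - by rewrite /upd eqxx (negbTE wy); clear; lia.
  - by move: reg; rewrite wt_upd updA yU wU; clear; lia.
  - by move=> A; rewrite wt_upd updA; clear; lia.
right; exists b.
have bw0 w : w \in U -> w != y -> b w = 0.
  move=> wU wy; have := none w wU; rewrite wy /= -leNgt => H.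
  by apply/eqP; rewrite eq_le H b0.
split=> //.
have: wt b U = b y.
  rewrite /wt (big_setD1 y) //= big1 ?addr0 // => w.
  by rewrite !inE => /andP[wy wU]; apply: bw0.
by move: m_ge3 noroom reg; clear; lia.
Qed.

(** All edges towards z0 are gathered at [y], then at [w]. The first state has none at [w], so
    [ecut + a] is at least 2m - 1 there; the second adds at least m - 1, exceeding the bound 3m -
    3. *)
Lemma upper_only_orientable U F s t p a b :
  orientable_below (#|U| + #|F|) -> (3 <= #|U|)%N ->
  valid U F s t p a b set0 -> upper_only U F s t p a b ->
  (forall A, A \proper U -> (2 <= #|A|)%N -> cut_ok F s t p a b 1 1 A) ->
  orientable U F s t p.
Proof.
move=> IH U3 val uo C1.
have /card_gt1P[y [w [yU wU yw]]] := ltnW U3.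
have [//|[b1 [val1 uo1 C11 z1 _]]] :=
  @grow_lower U F s t p a y (absz (3 * m - b y)%R) IH U3 yU b (lez_abs _)
    val uo C1.
have [//|[b2 [val2 uo2 _ _ bw2]]] := @grow_lower U F s t p a w
  (absz (3 * m - b1 w)%R) IH U3 wU b1 (lez_abs _) val1 uo1 C11.
have := upper_only_bounds uo1 wU; have := upper_only_bounds uo2 wU.
rewrite (z1 w wU) 1?eq_sym //; move: bw2; clear; lia.
Qed.

(** With [a = b = 0] and [X] empty, a cut of size at least 3m - 3 gives an interval of at least [m]
    integers, so this contains the orientation theorem for (3m-3)-edge connected graphs. *)
Lemma valid_orientable n : orientable_below n.
Proof.
elim: n => [//|n IHn] U F s t p a b X; rewrite ltnS => le_n val.
have IH : orientable_below (#|U| + #|F|).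
  move=> U' F' s' t' p' a' b' X' lt; apply: IHn; exact: leq_trans lt le_n.
case: (val) => ends a0 b0 [j0 tot] reg /andP[XU X1] ex cU.
have [U1|U2] := leqP #|U| 1.
  exists s; split=> [e _|x xU]; first by left.
  have Ux : U = [set x].
    by apply/esym/eqP; rewrite eqEcard sub1set xU cards1.
  exists (- j0); move: tot; rewrite /need (einnT ends) Ux wt1.
  have -> : outdeg F s x = #|F|%:Z.
    rewrite /outdeg (eq_bigr (fun=> 1)) ?sumr_const ?natz // => e /ends.
    by rewrite Ux !inE => /andP[/eqP -> _]; rewrite eqxx.
  by clear; lia.
have [X0|[x xX]] := set_0Vmem X; last first.
  have Xx : X = [set x] by apply/esym/eqP; rewrite eqEcard sub1set xX cards1.
  by rewrite Xx in val; apply: exempt_step IH val U2.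
rewrite X0 in val cU.
have C0 A : A \proper U -> A != set0 -> cut_ok F s t p a b 0 0 A.
  by move=> pA A0; apply: cU.
have [U3|U2'] := ltnP 2 #|U|.
  have [//|[C1 [lo|uo]]] := one_sided IH val U3; last first.
    exact: upper_only_orientable IH U3 val uo C1.
  apply: orientable_reverse.
  apply: (upper_only_orientable IH U3 (valid_reverse val)).
    by move=> x xU; rewrite !cut_ok_reverse; apply: lo.
  by move=> A pA A2; rewrite cut_ok_reverse; apply: C1.
have /card_gt1P[x [y [xU yU xy]]] := U2.
have Uxy : U = [set x; y].
  apply/esym/eqP; rewrite eqEcard cards2 xy U2' andbT subUset.
  by rewrite !sub1set xU yU.
have Ux : U :\: [set x] = [set y].
  apply/setP=> v; rewrite Uxy !inE; case: (v =P x) => [->|] //=.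
  by rewrite (negbTE xy).
have sx : [set x] \subset U by rewrite sub1set.
have := needC p ends sx; rewrite Ux tot => Hn.
have := wtID a sx; have := wtID b sx; rewrite Ux !wt1 => Hb Ha.
have := ecutC [set x] ends; rewrite Ux => Hc.
have /hitsP[i Hi] := C0 _ (proper1 U2 xU) (set1_neq0 x).
have /hitsP[k Hk] := C0 _ (proper1 U2 yU) (set1_neq0 y).
move: Hi Hk; rewrite !wt1 Hc => Hi Hk.
(* A value outside [0, ecut] at a vertex forces at least [m] apex edges of one direction there. By
   [v_reg] this cannot happen at both vertices, so the value at [x], or the complement of the value
   at [y], is a possible out-flow of [x]. *)
have [o jo obnd] : exists2 o, (exists j, o = need F s t p [set x] + j * m) &
    0 <= o <= ecut F s t [set x].
  have [H|H] := boolP (0 <= need F s t p [set x] + i * m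
                         <= ecut F s t [set x]).
    by exists (need F s t p [set x] + i * m); first exists i.
  exists (ecut F s t [set x] - (need F s t p [set y] + k * m)).
    by exists (- j0 - k); move: Hn; clear; lia.
  have := a0 x; have := a0 y; have := b0 x; have := b0 y.
  by move: H Hi Hk Ha Hb reg m_ge3; clear; lia.
apply: (absorb_step IH val _ xU yU xy _ jo obnd); first exact: sub0set.
move=> e /ends; rewrite Uxy !inE.
case: (s e =P x) => [sx'|_]; case: (t e =P x) => [tx|_] //=.
  by move=> /eqP ty _; left.
by rewrite andbT => /eqP sy _; right.
Qed.
End BoundaryOrientations.

(** * Switching, modulo orientations and minimal signatures *)

Section SwitchingEquivalence.
Local Set Implicit Arguments.
Local Unset Strict Implicit.
Variables (V E : finType) (G : graph V E).
Implicit Types (sigma : signature E) (tau : orientation E) (X : {set V}).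

Lemma incident_addb v e :
  incident G v e = (end1 G e == v) (+) (end2 G e == v).
Proof.
rewrite /incident; case: (end1 G e =P v) (loopless G e) => [<-|_ _].
  by rewrite eq_sym => /negbTE ->.
by case: (_ == _).
Qed.

(** Reversing the half-edges at [v] compensates the switch: it swaps [dplus] and [dminus] at [v] and
    changes nothing elsewhere. For either sign [tau e] records the half-edge at [end1], so its value
    flips only when [end1 G e] is [v]. *)
Lemma mod_orientation_switch m v sigma tau :
  mod_orientation G m (switch G v sigma) tau ->
  mod_orientation G m sigma (fun e => tau e (+) (end1 G e == v)).
Proof.
move=> ori x; have := ori x; pose tau' e := tau e (+) (end1 G e == v).
have flip e : (in_Eplus G sigma tau' x e =
    if x == v then in_Eminus G (switch G v sigma) tau x e
    else in_Eplus G (switch G v sigma) tau x e) *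
  (in_Eminus G sigma tau' x e =
    if x == v then in_Eplus G (switch G v sigma) tau x e
    else in_Eminus G (switch G v sigma) tau x e).
  rewrite /in_Eplus /in_Eminus /switch !incident_addb /tau'.
  have [->|xv] := eqVneq x v.
    move: (loopless G e); case: (end1 G e =P v) => [<-|_ _].
      by rewrite eq_sym => /negbTE ->; case: (sigma e); case: (tau e).
    by case: (end2 G e == v); case: (sigma e); case: (tau e).
  case: (end1 G e =P v) (loopless G e) => [->|_ _].
    rewrite eq_sym => /negbTE ->; rewrite [v == x]eq_sym (negbTE xv) /=.
    by case: (end2 G e == x); case: (sigma e); case: (tau e).
  case: (end2 G e =P v) => [->|_]; rewrite ?[v == x]eq_sym ?(negbTE xv);
  by case: (end1 G e == x); case: (end2 G e == x); case: (sigma e);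
    case: (tau e).
have [xv|xv] := boolP (x == v); [move/esym|];
by congr (_ = _ %[mod m]); apply: eq_card => e;
  rewrite !inE flip ?xv ?(negbTE xv).
Qed.

Lemma mod_orientation_equiv m sigma sigma' : sig_equiv G sigma sigma' ->
  (exists tau, mod_orientation G m sigma' tau) ->
  exists tau, mod_orientation G m sigma tau.
Proof.
elim=> [//|v sigma1 _ IH [tau /mod_orientation_switch ori]].
by apply: IH; eexists; exact: ori.
Qed.

Definition switch_set X sigma : signature E :=
  foldr (switch G) sigma (enum X).

Lemma switch_set_equiv X sigma : sig_equiv G sigma (switch_set X sigma).
Proof.
rewrite /switch_set; elim: (enum X) => [|v s IH] /=.
  exact: sig_equiv_refl.
exact: sig_equiv_step.
Qed.

Lemma switch_setE X sigma e :
  switch_set X sigma e = sigma e (+) ((end1 G e \in X) (+) (end2 G e \in X)).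
Proof.
rewrite /switch_set -!(mem_enum X).
elim: (enum X) (enum_uniq X) => [|v s IH] /=.
  by rewrite addbF.
case/andP=> vs /IH {}IH; rewrite /switch incident_addb IH !inE.
have nv x : x == v -> x \in s = false by move=> /eqP ->; apply: negbTE.
move: (nv (end1 G e)) (nv (end2 G e)).
case: (end1 G e == v) => [/(_ isT) ->|_];
case: (end2 G e == v) => [/(_ isT) ->|_] /=;
by case: (sigma e); case: (_ \in s); rewrite //=; case: (_ \in s).
Qed.

Lemma min_switch_cut sigma : exists X, forall A,
  (cut_size G A <= 2 * #|[pred e | ~~ switch_set X sigma e &
                           (end1 G e \in A) (+) (end2 G e \in A)]|)%N.
Proof.
have [X _ minX] := @arg_minnP _ set0 xpredT
  (fun X => neg_edges (switch_set X sigma)) isT.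
exists X => A; set sg := switch_set X sigma.
pose c e := (end1 G e \in A) (+) (end2 G e \in A).
change (cut_size G A <= 2 * #|[pred e | ~~ sg e & c e]|)%N.
(* Switching twice at a vertex cancels, so switching [X] and then [A] amounts to switching their
   symmetric difference. It swaps the signs on the cut of [A] only. *)
pose Y := (X :\: A) :|: (A :\: X).
have sgY e : switch_set Y sigma e = sg e (+) c e.
  rewrite /sg !switch_setE /c !inE.
  move: (_ \in A) (_ \in A) (_ \in X) (_ \in X).
  by case: (sigma e) => -[] [] [] [].
have := minX Y isT; rewrite -/sg.
have -> : neg_edges (switch_set Y sigma) =
    (#|[pred e | ~~ sg e & c e]| + #|[pred e | sg e & ~~ c e]|)%N.
  rewrite /neg_edges -(cardID c [pred e | switch_set Y sigma e]).
  by congr (_ + _)%N; apply: eq_card => e; rewrite !inE sgY /in_mem /=;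
    case: (sg e); case: (c e).
have -> : neg_edges sg =
    (#|[pred e | sg e & c e]| + #|[pred e | sg e & ~~ c e]|)%N.
  rewrite /neg_edges -(cardID c [pred e | sg e]).
  by congr (_ + _)%N; apply: eq_card => e; rewrite !inE /in_mem /=;
    case: (sg e); case: (c e).
have -> : cut_size G A =
    (#|[pred e | sg e & c e]| + #|[pred e | ~~ sg e & c e]|)%N.
  rewrite /cut_size -(cardID sg).
  by congr (_ + _)%N; apply: eq_card => e; rewrite !inE /c;
    case: (end1 G e \in A); case: (end2 G e \in A);
    rewrite /in_mem /=; case: (sg e).
clear; lia.
Qed.

End SwitchingEquivalence.

(** * Orienting the positive edges once the negative ones are fixed *)

Section PositiveSubgraph.
Local Open Scope ring_scope.
Local Set Implicit Arguments.
Local Unset Strict Implicit.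
Variables (V E : finType) (G : graph V E) (k : nat) (sigma : signature E).

Let m : int := (2 * k + 1)%N%:Z.
Let F := [set e | ~~ sigma e].
Let inc e x : int := (end1 G e == x)%:Z + (end2 G e == x)%:Z.

Lemma sum_ind (P : pred E) : \sum_e (P e)%:Z = #|[pred e | P e]|%:Z.
Proof.
rewrite (bigID P) /= [X in _ + X]big1 ?addr0 => [|e /negbTE -> //].
rewrite (eq_bigr (fun=> 1)) => [|e -> //].
by rewrite sumr_const natz.
Qed.

Let split_sign (phi : E -> int) :
  \sum_e phi e = \sum_(e in F) phi e + \sum_(e | sigma e) phi e :> int.
Proof.
rewrite (bigID sigma) /= addrC; congr (_ + _).
by apply: eq_bigl => e; rewrite inE.
Qed.

Let sum_inc (x : V) : \sum_(v in [set: V]) (x == v)%:Z = 1.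
Proof. by rewrite (wt_ind x) inE. Qed.

(** [S] is the set of sink edges. The condition on its size makes the total net contribution of the
    negative edges a multiple of [m], as [v_tot] requires. *)
Lemma orient_positive (S : {set E}) (q : int) :
  (0 < k)%N -> S \subset sigma ->
  2 * #|S|%:Z = (neg_edges sigma)%:Z + q * m ->
  (forall A : {set V}, A != set0 -> A != setT ->
     (6 * k <= #|[pred e | ~~ sigma e &
                  (end1 G e \in A) (+) (end2 G e \in A)]|)%N) ->
  exists tau : orientation E, mod_orientation G (2 * k + 1) sigma tau.
Proof.
move=> k0 Ssg cS cut.
have m3 : 3 <= m by rewrite /m; lia.
pose sgn e : int := 2 * (e \in S)%:Z - 1.
pose deg x : int := \sum_(e in F) inc e x.
pose bal x : int := \sum_(e | sigma e) sgn e * inc e x.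
(* The factor k + 1 is the inverse of 2 modulo [m]: the out-degree must satisfy
   [2 * outdeg - deg + bal = 0] modulo [m]. *)
pose p x : int := (k%:Z + 1) * (deg x - bal x).
have S_neg : #|S|%:Z = \sum_(e | sigma e) (e \in S)%:Z.
  have := split_sign (fun e => (e \in S)%:Z); rewrite sum_ind.
  rewrite [X in _ = X + _]big1 ?add0r => [<-|e].
    by congr (_%:Z); apply: eq_card => e.
  rewrite inE; case eS: (e \in S) => // /negP[].
  exact: (subsetP Ssg).
have N_neg : (neg_edges sigma)%:Z = \sum_(e | sigma e) 1.
  by rewrite sumr_const natz.
have wt_deg : wt deg setT = 2 * #|F|%:Z.
  rewrite /wt /deg exchange_big /=.
  rewrite (eq_bigr (fun=> 2)) => [|e _]; last by rewrite big_split /= !sum_inc.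
  by rewrite sumr_const pmulrn mulrzz.
have wt_bal : wt bal setT = 2 * q * m.
  rewrite /wt /bal exchange_big /=.
  rewrite (eq_bigr (fun e => 2 * (2 * (e \in S)%:Z - 1))) => [|e _]; last first.
    by rewrite -mulr_sumr big_split /= !sum_inc /sgn mulrC.
  rewrite -mulr_sumr sumrB -mulr_sumr -S_neg -N_neg; move: cS; clear; lia.
have wt_p : wt p setT = (k%:Z + 1) * (wt deg setT - wt bal setT).
  by rewrite -wtB /wt mulr_sumr.
have [] := @valid_orientable V E m m3 (#|[set: V]| + #|F|).+1 setT F
  (end1 G) (end2 G) p (fun=> 0) (fun=> 0) set0 (ltnSn _).
  have wtz A : wt (fun=> 0) A = 0 :> int by exact: big1.
  split=> //.
  - by move=> e _; rewrite !inE.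
  - exists (#|F|%:Z - (2 * k%:Z + 2) * q).
    rewrite /need (@einnT _ _ setT) => [|e _]; last by rewrite !inE.
    by rewrite wt_p wt_deg wt_bal /m; clear; lia.
  - by left; rewrite !wtz; move: m3; clear; lia.
  - by rewrite sub0set cards0.
  - by move=> x; rewrite inE.
  - move=> A pA A0 _; rewrite /cut_ok /hits !wtz.
    (* Since 6k = 3(m - 1), the interval contains [m] consecutive integers and so meets every
       residue class. *)
    have : (6 * k)%N%:Z <= ecut F (end1 G) (end2 G) A.
      have AT : A != setT.
        by case/properP: pA => _ [v _]; apply: contraNneq => ->.
      have := cut A A0 AT; rewrite -lez_nat -sum_ind split_sign.
      rewrite [X in _ + X]big1 ?addr0 => [|e -> //].
      rewrite /ecut
        (eq_bigr (fun e => ((end1 G e \in A) (+) (end2 G e \in A))%:Z)) //.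
      by move=> e; rewrite inE => ->.
    have : 0 < m by lia.
    move=> m0.
    have := ltz_pmod (need F (end1 G) (end2 G) p A - (m - 1 - 0 + 0)) m0.
    rewrite /m; clear; lia.
move=> h [hst hp].
pose tau e := if sigma e then e \in S else h e == end1 G e.
exists tau => x.
have [j Hj] := hp x (in_setT x).
pose diff e : int :=
  (in_Eplus G sigma tau x e)%:Z - (in_Eminus G sigma tau x e)%:Z.
have diffE :
    (dplus G sigma tau x)%:Z - (dminus G sigma tau x)%:Z = \sum_e diff e.
  by rewrite sumrB !sum_ind.
have diffF : \sum_(e in F) diff e = 2 * outdeg F h x - deg x.
  rewrite /outdeg /deg mulr_sumr -sumrB; apply: eq_bigr => e eF.
  rewrite /diff /in_Eplus /in_Eminus /tau /inc.
  move: (eF); rewrite inE => /negbTE ->.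
  case: (h e =P end1 G e) => [->|ne]; first by clear; lia.
  by case: (hst e eF) => // ->; clear; lia.
have diffN : \sum_(e | sigma e) diff e = bal x.
  apply: eq_bigr => e sg; rewrite /diff /in_Eplus /in_Eminus /tau sg /inc /sgn.
  rewrite incident_addb; move: (loopless G e).
  case: (end1 G e =P x) => [->|_]; last first.
    by case: (_ == x); case: (e \in S).
  by rewrite eq_sym => /negbTE ->; case: (e \in S).
have key : (dplus G sigma tau x)%:Z =
    (deg x - bal x + 2 * j) * m + (dminus G sigma tau x)%:Z.
  move: diffE; rewrite split_sign diffF diffN Hj /p /m; clear; lia.
suff : ((dplus G sigma tau x)%:Z = (dminus G sigma tau x)%:Z %[mod m])%Z.
  by rewrite /m !modz_nat => -[].
by rewrite key modzMDl.
Qed.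

End PositiveSubgraph.

Theorem theorem4 (k : nat) (V E : finType) (G : graph V E) (sigma : signature E) :
  0 < k ->
  edge_connected G (12 * k - 1) ->
  essentially_unbalanced G k sigma ->
  exists tau : orientation E, mod_orientation G (2 * k + 1) sigma tau.
Proof.
move=> k0 conn unb.
have [X minX] := min_switch_cut G sigma.
apply: (mod_orientation_equiv (switch_set_equiv G X sigma)).
have {unb} := unb _ (switch_set_equiv G X sigma).
move: (switch_set G X sigma) minX => sg minX unb.
have [c cN [q cq]] : exists2 c, c <= neg_edges sg &
    exists q : int, (2 * c%:Z = (neg_edges sg)%:Z + q * (2 * k + 1)%N%:Z)%R.
  have [odd_N|even_N] := boolP (odd (neg_edges sg)).
    (* For an odd number of negative edges the subtraction is not truncated, by unbalancedness, and
       the difference of two odd numbers is halved exactly. *)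
    exists (neg_edges sg - (2 * k + 1))./2; first by lia.
    by exists (-1)%R; move: unb; rewrite odd_N /=; lia.
  by exists (neg_edges sg)./2; [lia|exists 0%R; lia].
have [|S SN cS] := @subset_of_card E [set e | sg e] c; first by rewrite cardsE.
apply: (orient_positive (S := S) (q := q) k0).
- by apply/subsetP => e /(subsetP SN); rewrite inE.
- by rewrite cS.
(* Parity closes the gap: twice the number of positive cut edges is at least 12k - 1, hence at least
   12k. *)
- move=> A A0 AT; have := minX A; have := conn A A0 AT; lia.
Qed.
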